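(* Let $k\ge 3$ and let $P$ be a product of $k-2$ distinct primes, with largest prime factor $p$, and put $P_{k-3}=P/p$. Let $N(P)$ be the number of pairs of integers $(C,D)$ with $1\le D\le P-1$ and \[ \frac{(p-1)P^2-2P}{p+1}<CD<\frac{(p+3)P^2+2P}{p+1}.\] Then $N(P)=\Theta(P_{k-3}\,P\log P)$, and consequently $N(P)=O(P^{2-\frac{1}{k-2}}\log P)$.
   Context: These pairs $(C,D)$ are the candidate pairs generated by the ''$CD$ method'' for finding all absolute Lucas pseudoprimes of the form $Pqr$ ($q<r$ primes exceeding the prime factors of $P$). Asymptotic notation is as $P\to\infty$ (with $k$ fixed), with implied constants independent of $P$. *)

(* Defs.v *)
From mathcomp Require Import all_boot all_order all_algebra.
From mathcomp Require Import finmap.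
From mathcomp Require Import all_classical all_reals all_analysis.
From mathcomp Require Import zify.
Set Implicit Arguments.
Unset Strict Implicit.
Unset Printing Implicit Defensive.
Import Order.TTheory GRing.Theory Num.Theory.
Import numFieldNormedType.Exports.

Local Open Scope classical_set_scope.
Local Open Scope ring_scope.

Definition distinct_primes_product (m P : nat) : Prop :=
  exists s : seq nat,
    [/\ size s = m, uniq s, all prime s & P = (\prod_(q <- s) q)%N].

(* The largest prime factor p of P is [max_pdiv P]; the bounds on C * D are
   rational numbers, compared with the image of C * D in [rat]. *)
Definition CD_lower (P : nat) : rat :=
  let p := max_pdiv P in
  ((p%:R - 1) * P%:R ^+ 2 - 2 * P%:R) / (p%:R + 1).

Definition CD_upper (P : nat) : rat :=
  let p := max_pdiv P in
  ((p%:R + 3) * P%:R ^+ 2 + 2 * P%:R) / (p%:R + 1).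

Definition CD_pairs (P : nat) : set (int * int) :=
  [set CD | let: (C, D) := CD in
     1 <= D <= P%:Z - 1 /\ CD_lower P < (C * D)%:~R < CD_upper P].

(* [fset_set] sends infinite sets to the empty set; this lemma shows that the
   default value plays no role in [CD_count]. *)
Lemma finite_CD_pairs (P : nat) : finite_set (CD_pairs P).
Proof.
pose M := (Num.bound `|CD_lower P| + Num.bound `|CD_upper P|)%N.
pose I := [seq n%:Z | n <- iota 0 (M + P).+1] ++
          [seq - n%:Z | n <- iota 0 (M + P).+1].
have memI (z : int) : (`|z| <= M + P)%N -> z \in I.
  move=> zle; rewrite mem_cat; apply/orP.
  by case: (lerP 0 z) => z0; [left|right]; apply/mapP;
    exists `|z|%N; rewrite ?mem_iota; lia.
apply: (sub_finite_set (B := [set` I] `*` [set` I])).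
  move=> [C D] /= [/andP[D1 DP] /andP[lo hi]].
  have bnd : (`|(C * D)%R| <= M)%N.
    have lo' : - (Num.bound `|CD_lower P|)%:R < (C * D)%:~R :> rat.
      apply: le_lt_trans lo; rewrite lerNl.
      by rewrite (le_trans (ler_norm _)) // normrN ltW // archi_boundP.
    have hi' : (C * D)%:~R < (Num.bound `|CD_upper P|)%:R :> rat.
      apply: lt_trans hi _.
      by rewrite (le_lt_trans (ler_norm _)) // archi_boundP.
    move: lo' hi'; rewrite !(pmulrn 1) -mulrNz !ltr_int /M; lia.
  have D0 : (0 < `|D|)%N by lia.
  split; apply: memI; last by rewrite /=; lia.
  by move: bnd; rewrite /= abszM; nia.
by apply: finite_setX; exact: finite_seq.
Qed.

Definition CD_count (P : nat) : nat := #|` fset_set (CD_pairs P) |.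

(* Main.v *)
(* For fixed D, the admissible C are the integers of an open interval of length
   W / D, where W = 4P(P + 1)/(p + 1) lies between 2 P_{k-3} P and 4 P_{k-3} P,
   so there are W / D + O(1) of them.  Summing over 1 <= D <= P - 1 gives
   N(P) = W H_{P-1} + O(P), with H_n the harmonic sums.  The second bound
   follows from P <= p^(k-2). *)
Require Import Defs.
From mathcomp Require Import all_boot all_order all_algebra.
From mathcomp Require Import all_classical all_reals all_analysis.
From mathcomp Require Import finmap zify ring lra.
Import Order.TTheory GRing.Theory Num.Theory.
Import numFieldNormedType.Exports.
Local Open Scope classical_set_scope.
Local Open Scope ring_scope.

(** Passing from [n] to [n.+1] adds [ln (1 + 1/(n+1))] on the left, which is at most the new term
    [1/(n+1)]. *)
Lemma ln_le_harmonic_sum (R : realType) (n : nat) :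
  ln n.+1%:R <= \sum_(i < n) i.+1%:R^-1 :> R.
Proof.
elim: n => [|n IHn]; first by rewrite big_ord0 ln1.
have -> : n.+2%:R = n.+1%:R * (1 + n.+1%:R^-1) :> R.
  by rewrite mulrDr mulr1 divff ?pnatr_eq0// natr1.
rewrite lnM ?posrE ?addr_gt0 ?invr_gt0// big_ord_recr/= lerD//.
by rewrite le_ln1Dx// (lt_trans (ltrN10 _))// invr_gt0.
Qed.

(** The bound [ln (1 + t) <= t] at the negative point [t = -1/(n+2)] gives
    [1/(n+2) <= ln (n+2) - ln (n+1)], and these differences telescope. *)
Lemma harmonic_sum_le_ln (R : realType) (n : nat) :
  \sum_(i < n.+1) i.+1%:R^-1 <= 1 + ln n.+1%:R :> R.
Proof.
elim: n => [|n IHn]; first by rewrite big_ord1 ln1 invr1 addr0.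
have n1 : 0 < n.+1%:R :> R by [].
have n2_gt0 : 0 < n.+2%:R :> R by [].
have n2 : n.+2%:R = n.+1%:R + 1 :> R by rewrite natr1.
have x1 : 1 - n.+2%:R^-1 = n.+1%:R / n.+2%:R :> R.
  apply: (mulIf (lt0r_neq0 n2_gt0)).
  by rewrite mulrBl mulVf ?mulfVK ?lt0r_neq0// n2 mul1r addrK.
have := @le_ln1Dx R (- n.+2%:R^-1).
rewrite x1 ln_div ?posrE// ltrN2 invf_lt1// ltr1n => /(_ isT) step.
rewrite big_ord_recr/= (le_trans (lerD IHn (lexx _)))//.
by rewrite -addrA lerD2l -lerBrDr -lerBlDl.
Qed.

Lemma CD_width (P : nat) :
  CD_upper P - CD_lower P =
  4 * P%:R * (P%:R + 1) / ((max_pdiv P)%:R + 1).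
Proof.
by rewrite /CD_upper /CD_lower; field; rewrite natr1 pnatr_eq0.
Qed.

(** With [P = Q p], clearing [p + 1] reduces the two bounds to [Q <= Q p + 2] and [1 <= Q]. *)
Lemma CD_width_bounds (P : nat) : (0 < P)%N ->
  2 * P%:R * (P %/ max_pdiv P)%N%:R <= CD_upper P - CD_lower P
  <= 4 * P%:R * (P %/ max_pdiv P)%N%:R.
Proof.
move=> P0; rewrite CD_width.
have := divnK (max_pdiv_dvd P); set p := max_pdiv P; set Q := (P %/ p)%N.
move=> PE; have p0 : (1 <= p)%N by exact: max_pdiv_gt0.
have Q0 : (1 <= Q)%N by rewrite divn_gt0 ?max_pdiv_leq.
have PE' : P%:R = Q%:R * p%:R :> rat by rewrite -natrM PE.
rewrite -(ler1n rat) in p0; rewrite -(ler1n rat) in Q0.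
rewrite -(ltr0n rat) in P0.
rewrite ler_pdivlMr ?ler_pdivrMr; [|lra..].
rewrite PE' in P0 *; apply/andP; split; nra.
Qed.

(** Each of the [m] prime factors is at most the largest one, so [P <= p^m]; then take [m]-th
    roots. *)
Lemma powR_le_max_pdiv (R : realType) (m P : nat) : (0 < m)%N -> distinct_primes_product m P ->
  (P%:R : R) `^ (m%:R^-1) <= (max_pdiv P)%:R.
Proof.
move=> m0 [s [sm _ /allP sp PE]].
have P0 : (0 < P)%N by rewrite PE big_seq prodn_cond_gt0// => q /sp/prime_gt0.
have le : (P <= max_pdiv P ^ m)%N.
  rewrite {1}PE -sm -(count_predT s) -iter_muln_1 -big_const_seq big_seq [leqRHS]big_seq.
  apply: leq_prod => q qs; apply: max_pdiv_max.
  by rewrite mem_primes sp// P0 PE (big_rem q)//= dvdn_mulr.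
have -> : (max_pdiv P)%:R = ((max_pdiv P)%:R `^ m%:R) `^ (m%:R^-1) :> R.
  by rewrite -powRrM divff ?powRr1 ?pnatr_eq0 -?lt0n.
by rewrite ge0_ler_powR ?nnegrE ?powR_ge0// powR_mulrn// -natrX ler_nat.
Qed.

(** The shift by one lets [i < P.-1] cover exactly [1 <= D <= P - 1] and matches the terms of the
    harmonic sum. *)
Definition CD_fiber (P i : nat) : set (int * int) :=
  CD_pairs P `&` (fun CD => CD.2) @^-1` [set i.+1%:Z].

Lemma CD_count_fibers (P : nat) :
  CD_count P = (\sum_(i < P.-1) #|` fset_set (CD_fiber P i)|)%N.
Proof.
rewrite trivIset_sum_card; last first.
- by move=> i j _ _ [[C D] [[_ /= ->] [_ /= []]]].
- by move=> i; apply: finite_setIl; exact: finite_CD_pairs.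
- congr #|` fset_set _|%fset; rewrite -bigcup_mkord.
  rewrite /CD_fiber -setI_bigcupr; apply/seteqP; split=> [[C D] CDP|? []//].
  split=> //; have /andP[D1 DP] := CDP.1.
  by exists `|D|.-1%N => /=; lia.
Qed.

(** The integers strictly between [x] and [y] number [ceil y - floor x - 1], which differs from
    [y - x] by at most 1. *)
Lemma card_CD_fiber (R : realType) (P i : nat) : (i < P.-1)%N ->
    (CD_lower P < CD_upper P) ->
  `|#|` fset_set (CD_fiber P i)|%:R -
    ratr (CD_upper P - CD_lower P) / i.+1%:R| <= 1 :> R.
Proof.
move=> iP lu.
pose x := CD_lower P / i.+1%:R; pose y := CD_upper P / i.+1%:R.
have i0 : 0 < i.+1%:R :> rat by [].
have xy : x < y by rewrite ltr_pM2r ?invr_gt0.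
(* This makes [ceil y - floor x - 1] nonnegative, so the absolute value in [n] below does not change
   it. *)
have fy : Num.floor x < Num.ceil y.
  by rewrite -(ltr_int rat) (le_lt_trans (floor_le_tmp x))// (lt_le_trans xy)// ceil_ge.
have boundsE C : (CD_lower P < (C * i.+1%:Z)%:~R < CD_upper P) =
    (Num.floor x < C < Num.ceil y).
  rewrite intrM -pmulrn -ltr_pdivrMr// -(ltr_pdivlMr C%:~R _ i0).
  by rewrite -floor_lt_int -ceil_gt_int.
pose n := `|(Num.ceil y - Num.floor x - 1)%R|%N.
have -> : #|` fset_set (CD_fiber P i)| = n.
  apply: card_fset_set.
  pose g (j : nat) : int * int := (Num.floor x + 1 + j%:Z, i.+1%:Z).
  have -> : CD_fiber P i = g @` `I_n.
    apply/seteqP; split=> [[C D]|_ [j /= jn <-]].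
      move=> [[_ lCu] /= DE]; move: lCu; rewrite DE boundsE.
      move=> /andP[xC Cy]; exists `|(C - Num.floor x - 1)%R|%N; first by rewrite /n; lia.
      by congr pair; lia.
    split=> //; split; first lia.
    by rewrite boundsE; rewrite /n in jn; lia.
  by apply: inj_card_eq => j j' _ _ [] /addrI[].
have wE : ratr (CD_upper P - CD_lower P) / i.+1%:R = ratr (y - x) :> R.
  by rewrite -(mulrBl i.+1%:R^-1) [in RHS]rmorphM fmorphV/= ratr_nat.
have nE : n%:R = ratr (Num.ceil y - Num.floor x - 1)%:~R :> R.
  by rewrite ratr_int /n pmulrn gez0_abs//; lia.
rewrite wE nE -rmorphB -ratr_norm -(rmorph1 (@ratr R)) ler_rat ler_norml.
have /andP[] := floor_itv x; have /andP[] := ceil_itv y.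
rewrite !intrD !rmorphN/=; lra.
Qed.

(** The condition [P >= e] gives [ln P >= 1], so both the rounding error, at most [P], and the 1 in
    [1 + ln P] are absorbed into the main term. *)
Lemma CD_count_bounds (R : realType) (P : nat) : (0 < P)%N ->
    expR 1 <= P%:R :> R ->
  let g : R := (P %/ max_pdiv P)%:R * P%:R * ln P%:R in
  g <= (CD_count P)%:R /\ (CD_count P)%:R <= 9 * g.
Proof.
case: P => // n _ eP g; rewrite {}/g.
have /andP[wl wu] := @CD_width_bounds n.+1 isT.
have Q1 : 1 <= (n.+1 %/ max_pdiv n.+1)%:R :> R.
  by rewrite ler1n divn_gt0 ?max_pdiv_leq ?max_pdiv_gt0.
set w : R := ratr (CD_upper n.+1 - CD_lower n.+1).
have {}wl : 2 * n.+1%:R * (n.+1 %/ max_pdiv n.+1)%:R <= w.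
  by rewrite -(ler_rat R) !rmorphM/= !ratr_nat in wl.
have {}wu : w <= 4 * n.+1%:R * (n.+1 %/ max_pdiv n.+1)%:R.
  by rewrite -(ler_rat R) !rmorphM/= !ratr_nat in wu.
have w0 : 0 < w by rewrite (lt_le_trans _ wl)// !mulr_gt0// (lt_le_trans ltr01).
have lu : CD_lower n.+1 < CD_upper n.+1.
  by rewrite -subr_gt0 -(ltr_rat R) rmorph0.
pose H : R := \sum_(i < n) i.+1%:R^-1.
(* Each of the [n = P - 1] fibers contributes an error of at most 1. *)
have : `|(CD_count n.+1)%:R - w * H| <= n%:R.
  rewrite CD_count_fibers natr_sum mulr_sumr -sumrB.
  rewrite (le_trans (ler_norm_sum _ _ _))// -[n in leRHS]card_ord -sumr_const.
  by apply: ler_sum => i _; exact: card_CD_fiber.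
rewrite ler_norml.
have Hl : ln n.+1%:R <= H by exact: ln_le_harmonic_sum.
have Hu : H <= 1 + ln n.+1%:R.
  apply: le_trans (@harmonic_sum_le_ln R n).
  by rewrite big_ord_recr/= lerDl invr_ge0.
have l1 : 1 <= ln n.+1%:R :> R by rewrite -[leLHS]expRK ler_ln ?posrE ?expR_gt0.
have nP : n%:R <= n.+1%:R :> R by rewrite ler_nat.
move: Q1 wl wu Hl Hu l1 nP; set Q := (n.+1 %/ _)%:R; set X : R := n.+1%:R.
set L := ln X => Q1 wl wu Hl Hu l1 nP /andP[lo hi].
have X0 : 0 < X by [].
(* The rounding error is thus at most one [g]; with [2 g <= w H <= 8 g] this yields the constants
   [2 - 1 = 1] and [8 + 1 = 9]. *)
have PQ : X <= Q * X * L.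
  by rewrite mulrAC ler_peMl ?(ltW X0)// mulr_ege1.
have lower : 2 * (Q * X * L) <= w * H.
  rewrite (_ : 2 * _ = 2 * X * Q * L); last by ring.
  by apply: ler_pM; rewrite ?mulr_ge0; lra.
have upper : w * H <= 8 * (Q * X * L).
  rewrite (_ : 8 * _ = 4 * X * Q * (2 * L)); last by ring.
  by apply: ler_pM; lra.
split; lra.
Qed.

Theorem theorem5 (R : realType) (k : nat) (hk : (3 <= k)%N) :
  let F := within [set P : nat | distinct_primes_product (k - 2) P] \oo in
  let N : nat -> R^o := fun P => (CD_count P)%:R in
  (N =Theta_F (fun P : nat =>
     ((P %/ max_pdiv P)%N%:R * P%:R * ln (P%:R : R) : R^o))) /\
  (N =O_F (fun P : nat =>
     ((P%:R : R) `^ (2 - 1 / (k%:R - 2)) * ln (P%:R : R) : R^o))).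
Proof.
move=> F N.
have large : \forall P \near F, (0 < P)%N /\ expR 1 <= P%:R :> R.
  apply: cvg_within; near=> P; split; last by near: P; exact: nbhs_infty_ger.
  by near: P; exact: nbhs_infty_gt.
split.
  rewrite eqThetaE; apply/asboolP; exists (1, 9) => /=; first by rewrite ltr01 ltr0n.
  apply: filterS large => P [P0 eP]; have [lo hi] := CD_count_bounds R P P0 eP.
  by rewrite mul1r !ger0_norm ?ler0n ?mulr_ge0// ln_ge0// ler1n.
apply/eqO_exP; exists 9; first by rewrite ltr0n.
have prods : \forall P \near F, distinct_primes_product (k - 2) P by exact: withinT.
apply: filterS2 large prods => P [P0 eP] Pk.
have [_ hi] := CD_count_bounds R P P0 eP.
have lnP0 : 0 <= ln P%:R :> R by rewrite ln_ge0// ler1n.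
rewrite !ger0_norm ?ler0n ?mulr_ge0 ?powR_ge0//.
rewrite (le_trans hi)// ler_pM2l// ler_wpM2r//.
have k2 : (0 < k - 2)%N by lia.
have := powR_le_max_pdiv R _ _ k2 Pk; rewrite natrB ?(ltnW hk)// => root.
have Pn0 : P%:R != 0 :> R by rewrite pnatr_eq0 -lt0n.
(* Writing the power as [P^2] over [P^(1/(k-2))], it remains to see [Q P P^(1/(k-2)) <= P^2], which
   follows from [P^(1/(k-2)) <= p] and [P = Q p]. *)
rewrite powRB ?Pn0 ?implybT// div1r powR_mulrn// ler_pdivlMr ?powR_gt0 ?ltr0n//.
have PE : P%:R = (P %/ max_pdiv P)%:R * (max_pdiv P)%:R :> R.
  by rewrite -natrM divnK// max_pdiv_dvd.
rewrite expr2 [X in _ <= X * _]PE [leRHS]mulrAC ler_wpM2l// mulr_ge0//.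
Unshelve. all: by end_near.
Qed.
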